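(* Let $\Omega$ be a region of $\mathbb{C}$ and let $F:\Omega\to\mathbb{M}_n$ be a nonconstant analytic function. If $z_0\in\Omega$ is a point at which every one of the functions $z\mapsto s_k(F(z))$, $1\leq k\leq n$, attains its minimum value over $\Omega$, then $F(z_0)$ is not invertible.
   Context: A region is a nonempty open connected subset of $\mathbb{C}$. $\mathbb{M}_n$ is the set of $n\times n$ complex matrices; $F$ is analytic if each entry is analytic. For $A\in\mathbb{M}_n$, the singular values $s_1(A)\geq\cdots\geq s_n(A)$ are the nonnegative square roots of the eigenvalues of $A^*A$ in nonincreasing order. *)

(* Defs.v *)
From HB Require Import structures.
From mathcomp Require Import all_boot all_order all_algebra.
From mathcomp Require Import complex.
From mathcomp Require Import all_classical all_reals all_analysis.

Set Implicit Arguments.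
Unset Strict Implicit.
Unset Printing Implicit Defensive.

Import Order.TTheory GRing.Theory Num.Theory.
Import numFieldTopology.Exports numFieldNormedType.Exports.
Local Open Scope classical_set_scope.
Local Open Scope ring_scope.

(* Standard (modulus) topology / normed structure on C = R[i], inherited from
   its numFieldType structure (the norm is the complex modulus). *)
Set Warnings "-redundant-canonical-projection".
HB.instance Definition _ (R : rcfType) := PseudoPointedMetric.copy R[i] (R[i])^o.
HB.instance Definition _ (R : rcfType) := NormedModule.copy R[i] (R[i])^o.
Set Warnings "+redundant-canonical-projection".

Definition region (R : realType) (Om : set R[i]) : Prop :=
  Om !=set0 /\ open Om /\ connected Om.

Definition analytic_on (R : realType) (Om : set R[i]) (f : R[i] -> R[i]) : Prop :=
  forall z0, Om z0 ->
    exists r : R, 0 < r /\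
      (forall z : R[i], `|z - z0| < (r%:C)%C -> Om z) /\
      exists a : nat -> R[i],
        forall z : R[i], `|z - z0| < (r%:C)%C ->
          (fun N : nat => \sum_(k < N) a k * (z - z0) ^+ k) @ \oo --> f z.

Definition mx_analytic_on (R : realType) (n : nat) (Om : set R[i])
    (F : R[i] -> 'M[R[i]]_n) : Prop :=
  forall i j : 'I_n, analytic_on Om (fun z => F z i j).

Definition adjmx (R : realType) (m n : nat) (A : 'M[R[i]]_(m, n)) : 'M[R[i]]_(n, m) :=
  (map_mx Num.conj A)^T.

(* s is the sequence of singular values of A: s_1 >= ... >= s_n >= 0 and the
   s_k^2 are the eigenvalues of A^* A, listed with (algebraic) multiplicity,
   i.e. char_poly (A^* A) = prod_k (X - s_k^2). *)
Definition is_singvals (R : realType) (n : nat) (A : 'M[R[i]]_n)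
    (s : {ffun 'I_n -> R}) : Prop :=
  (forall k : 'I_n, 0 <= s k) /\
  (forall k l : 'I_n, (k <= l)%N -> s l <= s k) /\
  char_poly (adjmx A *m A) = \prod_(k < n) ('X - ((s k ^+ 2)%:C)%C%:P).

(* The singular values of A (s k = s_{k+1}(A) in the paper's 1-based
   indexing); chosen via xget, well defined since they exist and are unique. *)
Definition singvals (R : realType) (n : nat) (A : 'M[R[i]]_n) : {ffun 'I_n -> R} :=
  xget [ffun => 0] [set s | is_singvals A s].

(* Main.v *)
Require Import Defs.
From HB Require Import structures.
From mathcomp Require Import all_boot all_order all_algebra.
From mathcomp Require Import complex.
From mathcomp Require Import all_classical all_reals all_analysis.
From mathcomp Require Import ring lra.
Import Order.TTheory GRing.Theory Num.Theory.
Import numFieldTopology.Exports numFieldNormedType.Exports.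

Set Implicit Arguments.
Unset Strict Implicit.
Unset Printing Implicit Defensive.

Local Open Scope classical_set_scope.
Local Open Scope ring_scope.

(** Suppose [F z0] is invertible.  Since [|det F|] is the product of the singular
    values, it has a nonzero minimum at [z0]; as [det F] is analytic it must be
    constant near [z0], and since no [s_k] drops below its value at [z0], no [s_k]
    can exceed it either.  Hence the Frobenius norm, the sum of the [s_k ^ 2], is
    constant near [z0].  Writing [A = F z0], the inequality [|F z - A|^2 >= 0] gives
    [Re <A, F z> <= |A|^2 = <A, F z0>], so the analytic function [<A, F z>] is
    constant as well, whence [|F z - A|^2 = 0] near [z0] and [F] is constant on the
    region by the identity theorem.

    Power series are never multiplied: [det F] is only shown to have a polynomial
    expansion modulo [O(|h|^N)] for every [N], and each "constant" above is proved
    modulo [O(|h|^N)].  Only for the entries of [F], which are genuine power series,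
    does flatness to all orders turn into local constancy. *)

(** * The complex modulus and neighbourhoods of 0 *)

Local Notation nm := (@ComplexField.Normc.normc _).

(** The norm on [R[i]] takes its values in [R[i]]; estimates are carried out on the real number
    [nm z], where the order is total. *)
Lemma normr_normc (R : realType) (z : R[i]) : `|z| = ((nm z)%:C)%C.
Proof. by []. Qed.

Lemma nm_ge0 (R : realType) (z : R[i]) : 0 <= nm z.
Proof. by case: z => a b; rewrite /= sqrtr_ge0. Qed.

Lemma nm_gt0 (R : realType) (z : R[i]) : (0 < nm z) = (z != 0).
Proof. by rewrite -normr_gt0 normr_normc ltcR. Qed.

Lemma nm0 (R : realType) : nm (0 : R[i]) = 0.
Proof. exact: ComplexField.Normc.normc0. Qed.

Lemma nmD (R : realType) (z w : R[i]) : nm (z + w) <= nm z + nm w.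
Proof. by have := ler_normD z w; rewrite !normr_normc -rmorphD lecR. Qed.

Lemma nmN (R : realType) (z : R[i]) : nm (- z) = nm z.
Proof. by have := normrN z; rewrite !normr_normc => -[]. Qed.

Lemma nmB (R : realType) (z w : R[i]) : nm (z - w) <= nm z + nm w.
Proof. by rewrite -(nmN w); exact: nmD. Qed.

Lemma nm_distC (R : realType) (z w : R[i]) : nm (z - w) = nm (w - z).
Proof. by rewrite -opprB nmN. Qed.

Lemma nmM (R : realType) (z w : R[i]) : nm (z * w) = nm z * nm w.
Proof. exact: ComplexField.Normc.normcM. Qed.

Lemma nm_real (R : realType) (x : R) : nm (x%:C)%C = `|x|.
Proof. by rewrite /= expr0n /= addr0 sqrtr_sqr. Qed.

Lemma nmX (R : realType) (z : R[i]) k : nm (z ^+ k) = nm z ^+ k.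
Proof. by have := normrX k z; rewrite !normr_normc -rmorphXn => -[]. Qed.

Lemma Re_le_nm (R : realType) (z : R[i]) : complex.Re z <= nm z.
Proof.
by apply: le_trans (ler_norm _) _; have := normc_ge_Re z; rewrite normr_normc lecR.
Qed.

Lemma near0P (R : realType) (P : R[i] -> Prop) :
  (\forall h \near (0 : R[i]), P h) <->
  exists2 r : R, 0 < r & forall h, nm h < r -> P h.
Proof.
split=> [/nbhs_normP[/= e e0 He]|[r r0 Hr]].
  (* The radius [e] is a complex number; being positive it is real, so its real part defines the
     same ball. *)
  exists (complex.Re e); first by move: e0; rewrite ltcE => /andP[].
  move=> h hr; apply: He => /=; rewrite sub0r normrN normr_normc.
  by move: e0 hr; case: e => a b; rewrite !ltcE /= => /andP[/eqP <- _] ->; rewrite eqxx.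
apply/nbhs_normP; exists (r%:C)%C; first by rewrite /= ltcR.
by move=> h /=; rewrite sub0r normrN normr_normc ltcR; exact: Hr.
Qed.

Lemma near_nm_lt (R : realType) (r : R) : 0 < r -> \forall h \near (0 : R[i]), nm h < r.
Proof. by move=> r0; apply/near0P; exists r. Qed.

Lemma cvg_nm_lt (R : realType) (u : nat -> R[i]) (l : R[i]) : u @ \oo --> l ->
  forall e : R, 0 < e -> exists N0, forall N, (N0 <= N)%N -> nm (l - u N) < e.
Proof.
move=> /cvgrPdist_lt ul e e0.
have /ul[N0 _ H] : 0 < (e%:C)%C by rewrite ltcR.
by exists N0 => N /H; rewrite normr_normc ltcR.
Qed.

(** * Expansions at 0 modulo [O(|h|^N)] *)

Definition eqO (R : realType) (N : nat) (f g : R[i] -> R[i]) : Prop :=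
  exists C : R, \forall h \near (0 : R[i]), nm (f h - g h) <= C * nm h ^+ N.

Definition jet (R : realType) (N : nat) (f : R[i] -> R[i]) : Prop :=
  exists p : {poly R[i]}, eqO N f (horner p).

Lemma eqO_C (R : realType) N (f g : R[i] -> R[i]) : eqO N f g ->
  exists2 C : R, 0 <= C & \forall h \near (0 : R[i]), nm (f h - g h) <= C * nm h ^+ N.
Proof.
move=> [C HC]; exists `|C| => //; near=> h.
have H : nm (f h - g h) <= C * nm h ^+ N by near: h.
by apply: le_trans H _; rewrite ler_wpM2r ?exprn_ge0 ?nm_ge0 ?ler_norm.
Unshelve. all: by end_near. Qed.

(** The neighbourhood contains [h = 0] itself, where the error [C * 0 ^+ N] vanishes because [N] is
    positive. *)
Lemma eqO_at0 (R : realType) N (f g : R[i] -> R[i]) : (0 < N)%N -> eqO N f g -> f 0 = g 0.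
Proof.
case: N => // N _ [C /nbhs_singleton]; rewrite nm0 expr0n /= mulr0 => H.
apply/eqP; rewrite -subr_eq0; apply/eqP/ComplexField.Normc.eq0_normc/eqP.
by rewrite eq_le H nm_ge0.
Qed.

Lemma eqO_le (R : realType) M N (f g : R[i] -> R[i]) : (M <= N)%N -> eqO N f g -> eqO M f g.
Proof.
move=> MN /eqO_C[C C0 HC]; exists C; near=> h.
have H : nm (f h - g h) <= C * nm h ^+ N by near: h.
apply: le_trans H _; rewrite ler_wpM2l // ler_wiXn2l ?nm_ge0 //.
by apply: ltW; near: h; exact: near_nm_lt.
Unshelve. all: by end_near. Qed.

Lemma eqO_trans (R : realType) N (f g k : R[i] -> R[i]) :
  eqO N f g -> eqO N g k -> eqO N f k.
Proof.
move=> [C HC] [D HD]; exists (C + D); near=> h.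
have -> : f h - k h = (f h - g h) + (g h - k h) by ring.
apply: le_trans (nmD _ _) _; rewrite mulrDl lerD //; by near: h.
Unshelve. all: by end_near. Qed.

Lemma eqOD (R : realType) N (f1 f2 g1 g2 : R[i] -> R[i]) :
  eqO N f1 g1 -> eqO N f2 g2 -> eqO N (fun h => f1 h + f2 h) (fun h => g1 h + g2 h).
Proof.
move=> [C HC] [D HD]; exists (C + D); near=> h.
have -> : f1 h + f2 h - (g1 h + g2 h) = (f1 h - g1 h) + (f2 h - g2 h) by ring.
apply: le_trans (nmD _ _) _; rewrite mulrDl lerD //; by near: h.
Unshelve. all: by end_near. Qed.

Lemma horner_bounded (R : realType) (p : {poly R[i]}) :
  exists2 C : R, 0 <= C & \forall h \near (0 : R[i]), nm p.[h] <= C.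
Proof.
elim/poly_ind: p => [|p c [C C0 HC]].
  by exists 0 => //; near=> h; rewrite horner0 nm0.
exists (C + nm c); first by rewrite addr_ge0 ?nm_ge0.
near=> h; rewrite hornerMXaddC; apply: le_trans (nmD _ _) _; rewrite lerD2r nmM.
have H1 : nm p.[h] <= C by near: h.
have H2 : nm h < 1 by near: h; exact: near_nm_lt.
by rewrite -[C]mulr1 ler_pM ?nm_ge0 // ltW.
Unshelve. all: by end_near. Qed.

(** The difference of the polynomials is divisible by ['X^N], and the quotient is bounded near 0. *)
Lemma eqO_horner (R : realType) N (p q : {poly R[i]}) :
  (forall k, (k < N)%N -> p`_k = q`_k) -> eqO N (horner p) (horner q).
Proof.
move=> pq; have [C C0 HC] := horner_bounded (drop_poly N (p - q)).
exists C; near=> h.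
have -> : p.[h] - q.[h] = (drop_poly N (p - q)).[h] * h ^+ N.
  rewrite -hornerN -hornerD -{1}(poly_take_drop N (p - q)) hornerD hornerM hornerXn.
  suff -> : take_poly N (p - q) = 0 by rewrite horner0 add0r.
  apply/polyP=> k; rewrite coef_take_poly coef0; case: ltnP => // /pq.
  by rewrite coefB => ->; rewrite subrr.
by rewrite nmM nmX ler_wpM2r ?exprn_ge0 ?nm_ge0 //; near: h.
Unshelve. all: by end_near. Qed.

Lemma jetC (R : realType) N (c : R[i]) : jet N (fun=> c).
Proof. by exists c%:P; exists 0; near=> h; rewrite hornerC subrr nm0 mul0r. Unshelve. all: by end_near. Qed.

Lemma jetD (R : realType) N (f g : R[i] -> R[i]) :
  jet N f -> jet N g -> jet N (fun h => f h + g h).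
Proof.
move=> [p fp] [q gq]; exists (p + q).
have -> : horner (p + q) = (fun h => p.[h] + q.[h]) by apply/funext=> h; rewrite hornerD.
exact: eqOD.
Qed.

Lemma jetM (R : realType) N (f g : R[i] -> R[i]) :
  jet N f -> jet N g -> jet N (fun h => f h * g h).
Proof.
move=> [p /eqO_C[C C0 fp]] [q /eqO_C[D D0 gq]]; exists (p * q).
have [P P0 HP] := horner_bounded p; have [Q Q0 HQ] := horner_bounded q.
(* As [nm h ^+ N <= 1] near 0, [g] is bounded there by [D + Q]; the two summands match the two
   products in the splitting below. *)
exists (C * (D + Q) + P * D); near=> h.
have -> : f h * g h - (p * q).[h] = (f h - p.[h]) * (g h - q.[h] + q.[h]) + p.[h] * (g h - q.[h]).
  by rewrite hornerM; ring.
have h1 : nm h < 1 by near: h; exact: near_nm_lt.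
have hN : nm h ^+ N <= 1 by rewrite exprn_ile1 ?nm_ge0 // ltW.
have hN0 : 0 <= nm h ^+ N by rewrite exprn_ge0 ?nm_ge0.
have H1 : nm (f h - p.[h]) <= C * nm h ^+ N by near: h.
have H2 : nm (g h - q.[h]) <= D * nm h ^+ N by near: h.
have H3 : nm p.[h] <= P by near: h.
have H4 : nm q.[h] <= Q by near: h.
apply: le_trans (nmD _ _) _; rewrite [leRHS]mulrDl lerD // nmM.
  rewrite mulrAC ler_pM ?nm_ge0 //; apply: le_trans (nmD _ _) _; rewrite lerD //.
  by apply: le_trans H2 _; rewrite -[leRHS]mulr1 ler_wpM2l.
by rewrite -mulrA ler_pM ?nm_ge0.
Unshelve. all: by end_near. Qed.

Lemma jet_sum (R : realType) N (I : Type) (r : seq I) (P : pred I) (f : I -> R[i] -> R[i]) :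
  (forall i, jet N (f i)) -> jet N (fun h => \sum_(i <- r | P i) f i h).
Proof.
move=> jf; elim: r => [|i r IH].
  by under eq_fun do rewrite big_nil; exact: jetC.
under eq_fun do rewrite big_cons; case: (P i) => //; exact: jetD.
Qed.

Lemma jet_prod (R : realType) N (I : Type) (r : seq I) (P : pred I) (f : I -> R[i] -> R[i]) :
  (forall i, jet N (f i)) -> jet N (fun h => \prod_(i <- r | P i) f i h).
Proof.
move=> jf; elim: r => [|i r IH].
  by under eq_fun do rewrite big_nil; exact: jetC.
under eq_fun do rewrite big_cons; case: (P i) => //; exact: jetM.
Qed.

(** [\det] unfolds to the Leibniz formula, a finite sum of products of entries. *)
Lemma jet_det (R : realType) N n (F : R[i] -> 'M[R[i]]_n) :
  (forall i j, jet N (fun h => F h i j)) -> jet N (fun h => \det (F h)).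
Proof.
move=> jF; apply: jet_sum => s; apply: jetM; first exact: jetC.
exact: jet_prod.
Qed.

(** * Leading terms and extremum principles to finite order *)

Definition leading (R : realType) (f : R[i] -> R[i]) (m : nat) (a : R[i]) : Prop :=
  [/\ (0 < m)%N, a != 0 & eqO m.+1 f (fun h => f 0 + a * h ^+ m)].

(** The exponent [m] is the least positive index below [N] with a nonzero coefficient. The first
    alternative is phrased on coefficients so that it can later be tested on a power series. *)
Lemma jet_leading (R : realType) N (f : R[i] -> R[i]) (p : {poly R[i]}) :
  (0 < N)%N -> eqO N f (horner p) ->
  (forall k, (0 < k < N)%N -> p`_k = 0) \/ exists m a, (m < N)%N /\ leading f m a.
Proof.
move=> N0 fp; have [/existsP[m0 Hm0]|/existsPn H] := boolP [exists k : 'I_N, (0 < k)%N && (p`_k != 0)].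
  right; have exm : exists m, [&& (0 < m)%N, (m < N)%N & p`_m != 0].
    by exists m0; move/andP: Hm0 => [-> ->]; rewrite ltn_ord.
  case: (ex_minnP exm) => m /and3P[m_gt0 mN pm] mmin.
  exists m, p`_m; split => //; split=> //.
  apply: (@eqO_trans _ _ _ (horner p)); first exact: eqO_le fp.
  have -> : (fun h => f 0 + p`_m * h ^+ m) = horner ((p`_0)%:P + p`_m *: 'X^m).
    apply/funext=> h; rewrite hornerD hornerC hornerZ hornerXn.
    by rewrite (eqO_at0 N0 fp) horner_coef0.
  apply: eqO_horner => k; rewrite ltnS => km.
  rewrite coefD coefC coefZ coefXn; case: k km => [_|k km] /=.
    by rewrite eq_sym (gtn_eqF m_gt0) mulr0 addr0.
  rewrite add0r; move: km; rewrite leq_eqVlt => /orP[/eqP ->|km]; first by rewrite eqxx mulr1.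
  rewrite (ltn_eqF km) mulr0; apply/eqP; apply: contraTT km => pk; rewrite -leqNgt.
  have [kN|Nk] := ltnP k.+1 N; first by apply: mmin; rewrite /= kN.
  exact: leq_trans (ltnW mN) Nk.
left=> k /andP[k0 kN]; have := H (Ordinal kN); rewrite /= k0 /= => /negPn /eqP ->//.
Qed.

Lemma jet_cases (R : realType) N (f : R[i] -> R[i]) : (0 < N)%N -> jet N f ->
  eqO N f (fun=> f 0) \/ exists m a, (m < N)%N /\ leading f m a.
Proof.
move=> N0 [p fp]; have [H|] := jet_leading N0 fp; [left|by right].
apply: (@eqO_trans _ _ _ (horner p)) => //.
have -> : (fun _ : R[i] => f 0) = horner ((p`_0)%:P).
  by apply/funext=> h; rewrite hornerC (eqO_at0 N0 fp) horner_coef0.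
apply: eqO_horner => -[|k] kN; rewrite coefC //=.
exact: H.
Qed.

(* Along the ray through an [m]-th root of [s / a], [f] moves away from [f 0] in the
   prescribed direction [s]. *)
Lemma leading_direction (R : realType) (f : R[i] -> R[i]) m a (s : R[i])
    (P : R[i] -> Prop) :
  leading f m a -> (\forall h \near (0 : R[i]), P h) ->
  exists2 K : R, 0 <= K & exists2 r : R, 0 < r & forall t : R, 0 < t < r ->
    exists h, [/\ P h, nm h <= K * t &
      nm (f h - f 0 - s * (t%:C)%C ^+ m) <= K * t ^+ m.+1].
Proof.
move=> [m0 a0 /eqO_C[C C0 H]] HP.
have /near0P[r r0 {HP}H] : \forall h \near (0 : R[i]), P h /\
    nm (f h - (f 0 + a * h ^+ m)) <= C * nm h ^+ m.+1.
  by near=> h; split; near: h.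
pose w := m.-root (s / a).
have K0 : 0 <= C * nm w ^+ m.+1 by rewrite mulr_ge0 ?exprn_ge0 ?nm_ge0.
(* With [h = t w], the first summand bounds [nm h] and the second the remainder, so a single [K]
   serves both estimates. *)
exists (nm w + C * nm w ^+ m.+1); first by rewrite addr_ge0 ?nm_ge0.
exists (r / (nm w + 1)); first by rewrite divr_gt0 // ltr_wpDl ?nm_ge0.
move=> t /andP[t0 tr]; exists (t%:C * w)%C.
have ht : nm (t%:C * w)%C = t * nm w by rewrite nmM nm_real gtr0_norm.
have /H[Ph fh] : nm (t%:C * w)%C < r.
  rewrite ht; move: tr; rewrite ltr_pdivlMr ?ltr_wpDl ?nm_ge0 //; apply: le_lt_trans.
  by rewrite mulrDr mulr1 lerDl ltW.
split=> //.
  by rewrite ht mulrC ler_wpM2r ?(ltW t0) // lerDl.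
move: fh; rewrite ht exprMn rootCK // (_ : f 0 + _ = f 0 + s * (t%:C)%C ^+ m); last first.
  by field; exact: a0.
rewrite opprD addrA => /le_trans; apply.
by rewrite exprMn mulrA mulrAC ler_wpM2r ?exprn_ge0 ?(ltW t0) // lerDr nm_ge0.
Unshelve. all: by end_near. Qed.

(** Near 0 the remainder is at most half of the leading term, which leaves the other half as a lower
    bound. *)
Lemma leading_lower (R : realType) (f : R[i] -> R[i]) m a : leading f m a ->
  exists2 k : R, 0 < k & \forall h \near (0 : R[i]), k * nm h ^+ m <= nm (f h - f 0).
Proof.
move=> [m0 a0 /eqO_C[C C0 H]].
have na : 0 < nm a by rewrite nm_gt0.
exists (nm a / 2); first by rewrite divr_gt0.
near=> h.
have Hh : nm (f h - (f 0 + a * h ^+ m)) <= C * nm h ^+ m.+1 by near: h.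
have hr : nm h < nm a / (2 * (C + 1)).
  by near: h; apply: near_nm_lt; rewrite divr_gt0 // mulr_gt0 // ltr_wpDl.
have hC : C * nm h <= nm a / 2.
  move: hr; rewrite ltr_pdivlMr ?mulr_gt0 ?ltr_wpDl // => hr.
  by have := nm_ge0 h; lra.
have E : nm (a * h ^+ m) <= nm (f h - f 0) + nm (f h - (f 0 + a * h ^+ m)).
  rewrite [X in nm X <= _](_ : a * h ^+ m = (f h - f 0) - (f h - (f 0 + a * h ^+ m))); last by ring.
  exact: nmB.
have : C * nm h * nm h ^+ m <= nm a / 2 * nm h ^+ m.
  by rewrite ler_wpM2r ?exprn_ge0 ?nm_ge0.
move: E Hh; rewrite nmM nmX exprS; lra.
Unshelve. all: by end_near. Qed.

(** Dividing by [t ^+ m] leaves [c <= K * t], which fails for small [t]: a term of order [m] cannot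
    be absorbed by an error of order [m.+1]. *)
Lemma pow_small_absurd (R : realType) m (c K r : R) : 0 < c -> 0 < r ->
  (forall t, 0 < t < r -> c * t ^+ m <= K * t ^+ m.+1) -> False.
Proof.
move=> c0 r0 H.
pose t := Num.min (r / 2) (c / (2 * (`|K| + 1))).
have K1 : 0 < 2 * (`|K| + 1) by rewrite mulr_gt0 // ltr_wpDl.
have t0 : 0 < t by rewrite lt_min !divr_gt0.
have tr : t < r by rewrite gt_min; apply/orP; left; lra.
have : t <= c / (2 * (`|K| + 1)) by rewrite ge_min lexx orbT.
rewrite ler_pdivlMr // => tK.
have := H t; rewrite t0 tr exprS mulrA ler_pM2r ?exprn_gt0 // => /(_ isT).
have : K * t <= `|K| * t by rewrite ler_wpM2r ?ler_norm // ltW.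
lra.
Qed.

(** Otherwise [f] has a leading term of order [m < N]. Moving in the direction [- f 0] gives
    [|f h| <= |f 0| (1 - t^m) + K t^(m+1)], which is below [|f 0|] for small [t]. *)
Lemma jet_min_modulus (R : realType) N (f : R[i] -> R[i]) : (0 < N)%N -> jet N f ->
  f 0 != 0 -> (\forall h \near (0 : R[i]), nm (f 0) <= nm (f h)) ->
  eqO N f (fun=> f 0).
Proof.
move=> N0 jf f0 H; have [//|[m [a [mN lf]]]] := jet_cases N0 jf; exfalso.
have [K K0 [r r0 Hr]] := leading_direction (- f 0) lf H.
apply: (@pow_small_absurd R m (nm (f 0)) K (Num.min r 1)).
- by rewrite nm_gt0.
- by rewrite lt_min r0 ltr01.
move=> t /andP[t0]; rewrite lt_min => /andP[tr t1].
have [h [fh _ E]] := Hr t ltac:(by rewrite t0 tr).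
have tm : t ^+ m <= 1 by rewrite exprn_ile1 // ltW.
have : nm (f h) <= nm (f 0 * ((1 - t ^+ m)%:C)%C)
       + nm (f h - f 0 - - f 0 * (t%:C)%C ^+ m).
  rewrite [X in nm X <= _](_ : f h = f 0 * ((1 - t ^+ m)%:C)%C
       + (f h - f 0 - - f 0 * (t%:C)%C ^+ m)); first exact: nmD.
  by rewrite rmorphB rmorph1 rmorphXn; ring.
rewrite nmM nm_real ger0_norm ?subr_ge0 //; lra.
Qed.

(** Moving in the direction 1 raises the real part by [t^m] up to order [m + 1], too much for the
    allowed excess. The excess is permitted because the bound available for the inner product holds
    only modulo [O(|h|^N)]. *)
Lemma jet_max_Re (R : realType) N (f : R[i] -> R[i]) (C : R) : (0 < N)%N -> jet N f ->
  (\forall h \near (0 : R[i]), complex.Re (f h) <= complex.Re (f 0) + C * nm h ^+ N) ->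
  eqO N f (fun=> f 0).
Proof.
move=> N0 jf H; have [//|[m [a [mN lf]]]] := jet_cases N0 jf; exfalso.
(* Since [m < N], the excess may be weakened to order [m.+1], the order of the other error terms. *)
have H' : \forall h \near (0 : R[i]),
    complex.Re (f h) <= complex.Re (f 0) + `|C| * nm h ^+ m.+1.
  near=> h.
  have E : complex.Re (f h) <= complex.Re (f 0) + C * nm h ^+ N by near: h.
  apply: le_trans E _; rewrite lerD2l.
  apply: (@le_trans _ _ (`|C| * nm h ^+ N)).
    by rewrite ler_wpM2r ?exprn_ge0 ?nm_ge0 ?ler_norm.
  rewrite ler_wpM2l // ler_wiXn2l ?nm_ge0 //.
  by apply: ltW; near: h; exact: near_nm_lt.
have [K K0 [r r0 Hr]] := leading_direction 1 lf H'.
apply: (@pow_small_absurd R m 1 (K + `|C| * K ^+ m.+1) r) => // t /andP[t0 tr].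
have [h [fh hK E]] := Hr t ltac:(by rewrite t0 tr).
have hm : nm h ^+ m.+1 <= K ^+ m.+1 * t ^+ m.+1.
  by rewrite -exprMn lerXn2r ?nnegrE ?nm_ge0 // mulr_ge0 // ltW.
have := Re_le_nm (- (f h - f 0 - 1 * (t%:C)%C ^+ m)); rewrite nmN.
have -> : complex.Re (- (f h - f 0 - 1 * (t%:C)%C ^+ m))
        = t ^+ m - (complex.Re (f h) - complex.Re (f 0)).
  by rewrite mul1r -rmorphXn; case: (f h) (f 0) => [x y] [x' y'] /=; ring.
have : `|C| * nm h ^+ m.+1 <= `|C| * (K ^+ m.+1 * t ^+ m.+1) by rewrite ler_wpM2l.
lra.
Unshelve. all: by end_near. Qed.

(** * Jets of convergent power series *)

(** A term is the difference of two consecutive partial sums, both within 1 of the limit from [N0]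
    on, hence at most 2; the earlier terms are added to the bound. *)
Lemma pseries_coef_bound (R : realType) (a : nat -> R[i]) (h0 l : R[i]) :
  (fun N : nat => \sum_(k < N) a k * h0 ^+ k) @ \oo --> l ->
  exists2 B : R, 0 <= B & forall k, nm (a k) * nm h0 ^+ k <= B.
Proof.
move=> /cvg_nm_lt/(_ 1 ltr01)[N0 HN].
exists (2 + \sum_(k < N0) nm (a k) * nm h0 ^+ k).
  by rewrite addr_ge0 // sumr_ge0 // => k _; rewrite mulr_ge0 ?exprn_ge0 ?nm_ge0.
move=> k; have [kN|Nk] := ltnP k N0.
  rewrite (bigD1 (Ordinal kN)) //= addrCA lerDl addr_ge0 // sumr_ge0 // => j _.
  by rewrite mulr_ge0 ?exprn_ge0 ?nm_ge0.
apply: (@le_trans _ _ 2); last first.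
  by rewrite lerDl sumr_ge0 // => j _; rewrite mulr_ge0 ?exprn_ge0 ?nm_ge0.
have H1 := HN _ Nk; have H2 := HN _ (leqW Nk).
rewrite -nmX -nmM.
have -> : a k * h0 ^+ k = (l - \sum_(j < k) a j * h0 ^+ j)
    - (l - \sum_(j < k.+1) a j * h0 ^+ j) by rewrite big_ord_recr /=; ring.
by apply: le_trans (nmB _ _) _; lra.
Qed.

(** Convergence at [r / 2] bounds the terms there by [B]. With [x] the ratio of [nm h] to [r / 2],
    the series is dominated by [B x^k], and [x <= 1/2] makes its tail at most [2 B x^N]. *)
Lemma pseries_eqO (R : realType) (f : R[i] -> R[i]) (a : nat -> R[i]) (r : R) :
  0 < r ->
  (forall h, nm h < r -> (fun N : nat => \sum_(k < N) a k * h ^+ k) @ \oo --> f h) ->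
  forall N, eqO N f (horner (\poly_(k < N) a k)).
Proof.
move=> r0 H N.
have nr : nm ((r / 2)%:C)%C = r / 2 by rewrite nm_real gtr0_norm ?divr_gt0.
have /H/pseries_coef_bound[B B0] : nm ((r / 2)%:C)%C < r by rewrite nr; lra.
rewrite nr => HB.
have r2 : 0 < r / 2 by rewrite divr_gt0.
exists (2 * B / (r / 2) ^+ N); near=> h.
have hr : nm h < r / 4 by near: h; apply: near_nm_lt; rewrite divr_gt0.
pose x := nm h / (r / 2).
have x0 : 0 <= x by rewrite divr_ge0 ?nm_ge0 // ltW.
have x2 : x <= 2^-1 by rewrite /x ler_pdivrMr //; lra.
have xB k : nm (a k) * nm h ^+ k <= B * x ^+ k.
  have -> : nm h = r / 2 * x by rewrite /x; field; exact: lt0r_neq0.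
  by rewrite exprMn mulrA ler_wpM2r ?exprn_ge0.
(* The factor [1 - 2^-1 ^+ j] is half the partial geometric sum, the exact form that the induction
   reproduces. *)
have tail j : nm (\sum_(k < N + j) a k * h ^+ k - \sum_(k < N) a k * h ^+ k)
    <= 2 * B * x ^+ N * (1 - 2^-1 ^+ j).
  elim: j => [|j IH]; first by rewrite addn0 subrr nm0 expr0 subrr mulr0.
  rewrite addnS big_ord_recr /= addrAC; apply: le_trans (nmD _ _) _.
  have := xB (N + j)%N; rewrite nmM nmX (exprD x).
  have : B * x ^+ N * x ^+ j <= B * x ^+ N * 2^-1 ^+ j.
    by rewrite ler_wpM2l ?mulr_ge0 ?exprn_ge0 // lerXn2r ?nnegrE ?invr_ge0.
  move: IH; rewrite (exprS 2^-1); move: (2^-1 ^+ j) (x ^+ N) (x ^+ j) => u v w; lra.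
have -> : (\poly_(k < N) a k).[h] = \sum_(k < N) a k * h ^+ k by rewrite horner_poly.
have -> : 2 * B / (r / 2) ^+ N * nm h ^+ N = 2 * B * x ^+ N.
  by rewrite /x (expr_div_n (nm h)) [RHS]mulrA mulrAC.
(* The tail bound is uniform in the number of terms, so it passes to the limit up to an arbitrary
   [e]. *)
apply/ler_addgt0Pr => e e0.
have /H/cvg_nm_lt/(_ _ e0)[N0 HN] : nm h < r by lra.
have := HN (N + N0)%N (leq_addl _ _); have := tail N0.
have : 0 <= 2 * B * x ^+ N * 2^-1 ^+ N0 by rewrite !mulr_ge0 ?exprn_ge0 ?invr_ge0.
set S := \sum_(k < N + N0) _; set T := \sum_(k < N) _ => E1 E2 E3.
have -> : f h - T = (f h - S) + (S - T) by ring.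
by apply: le_trans (nmD _ _) _; lra.
Unshelve. all: by end_near. Qed.

(** Either all coefficients of positive index vanish and the sum of the series is constant, or a
    nonzero one forces a leading term. *)
Lemma analytic_local (R : realType) (Om : set R[i]) (f : R[i] -> R[i]) (z : R[i]) :
  analytic_on Om f -> Om z ->
  (forall N, jet N (fun h => f (z + h))) /\
  ((\forall h \near (0 : R[i]), f (z + h) = f z) \/
   exists m a, leading (fun h => f (z + h)) m a).
Proof.
move=> fan /fan[r [r0 [_ [a Ha]]]].
pose g h := f (z + h).
have Hg h : nm h < r -> (fun N : nat => \sum_(k < N) a k * h ^+ k) @ \oo --> g h.
  move=> hr; have := Ha (z + h); rewrite /g.
  have -> : z + h - z = h by ring.
  by rewrite normr_normc ltcR; exact.
have gO := pseries_eqO r0 Hg.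
split=> [N|]; first by exists (\poly_(k < N) a k).
have [/existsNP[k /not_implyP[k0 ak]]|a0] := pselect (~ forall k, (0 < k)%N -> a k = 0).
  (* Truncating at [k.+1] keeps the nonzero coefficient [a k] among those tested. *)
  right; have [H|[m [b [_ lg]]]] := jet_leading (ltn0Sn k) (gO k.+1); last by exists m, b.
  by exfalso; apply: ak; have := H k; rewrite k0 ltnSn coef_poly ltnSn; exact.
left; apply/near0P; exists r => // h hr.
move/contrapT in a0.
have g0 : g 0 = a 0%N.
  by rewrite (eqO_at0 (ltn0Sn 0) (gO 1%N)) horner_coef0 coef_poly.
have -> : f z = a 0%N by rewrite -g0 /g addr0.
apply/eqP; rewrite -subr_eq0; apply/eqP/ComplexField.Normc.eq0_normc/eqP.
rewrite eq_le nm_ge0 andbT; apply/ler_addgt0Pr => e e0; rewrite add0r.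
have [N0 HN] := cvg_nm_lt (Hg _ hr) e0.
have := HN N0.+1 (leqW (leqnn _)); rewrite big_ord_recl /= expr0 mulr1.
rewrite big1 ?addr0 => [/ltW //|i _]; by rewrite a0 // mul0r.
Qed.

(** * Frobenius norm, singular values and determinant *)

Definition frob2 (R : realType) m n (A : 'M[R[i]]_(m, n)) : R :=
  \sum_i \sum_j nm (A i j) ^+ 2.

Lemma nm_sqr (R : realType) (z : R[i]) : ((nm z ^+ 2)%:C)%C = z * Num.conj z.
Proof. by rewrite -normCK normr_normc rmorphXn. Qed.

Lemma tr_mul_adjmx (R : realType) m n (A : 'M[R[i]]_(m, n)) :
  \tr (A *m adjmx A) = ((frob2 A)%:C)%C.
Proof.
rewrite /mxtrace /frob2 rmorph_sum; apply: eq_bigr => i _.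
rewrite mxE rmorph_sum; apply: eq_bigr => j _.
by rewrite !mxE -nm_sqr.
Qed.

Lemma frob2_ge0 (R : realType) m n (A : 'M[R[i]]_(m, n)) : 0 <= frob2 A.
Proof. by do 2!apply: sumr_ge0 => ? _; rewrite sqr_ge0. Qed.

Lemma entry_le_frob2 (R : realType) m n (A : 'M[R[i]]_(m, n)) i j :
  nm (A i j) ^+ 2 <= frob2 A.
Proof.
rewrite /frob2 (bigD1 i) //= (bigD1 j) //= -addrA lerDl addr_ge0 //.
  by apply: sumr_ge0 => ? _; rewrite sqr_ge0.
by do 2!apply: sumr_ge0 => ? _; rewrite sqr_ge0.
Qed.

Lemma frob2_gt0 (R : realType) m n (A : 'M[R[i]]_(m, n)) : A != 0 -> 0 < frob2 A.
Proof.
move=> A0; rewrite lt_neqAle frob2_ge0 andbT eq_sym; apply: contra_neq A0 => A0.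
apply/matrixP => i j; rewrite mxE; apply/ComplexField.Normc.eq0_normc/eqP.
by rewrite -sqrf_eq0 eq_le sqr_ge0 andbT -A0 entry_le_frob2.
Qed.

Lemma adjmxM (R : realType) m n p (A : 'M[R[i]]_(m, n)) (B : 'M[R[i]]_(n, p)) :
  adjmx (A *m B) = adjmx B *m adjmx A.
Proof. by rewrite /adjmx map_mxM trmx_mul. Qed.

Lemma adjmxK (R : realType) m n (A : 'M[R[i]]_(m, n)) : adjmx (adjmx A) = A.
Proof. by apply/matrixP => i j; rewrite !mxE conjCK. Qed.

(** For a row eigenvector [v], multiplying by [adjmx v] gives [|v A^*|^2 = a |v|^2], with
    [|v|^2 > 0]. *)
Lemma eigenvalue_gram_ge0 (R : realType) n (A : 'M[R[i]]_n) (a : R[i]) :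
  eigenvalue (adjmx A *m A) a -> 0 <= a.
Proof.
move=> /eigenvalueP[v va v0].
have : \tr ((v *m adjmx A) *m adjmx (v *m adjmx A)) = a * \tr (v *m adjmx v).
  by rewrite adjmxM adjmxK !mulmxA -(mulmxA v) va -scalemxAl mxtraceZ.
rewrite !tr_mul_adjmx => E.
have v1 : 0 < ((frob2 v)%:C)%C by rewrite ltcR frob2_gt0.
by rewrite -(pmulr_lge0 _ v1) -E lecR frob2_ge0.
Qed.

(** This ensures that [xget] in [singvals] never falls back on its default value. The roots of the
    characteristic polynomial are nonnegative; their square roots are sorted in nonincreasing
    order. *)
Lemma is_singvals_exists (R : realType) n (A : 'M[R[i]]_n) :
  exists s, is_singvals A s.
Proof.
set M := adjmx A *m A.
have [rs Hrs] := closed_field_poly_normal (char_poly M).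
rewrite (monicP (char_poly_monic M)) scale1r in Hrs.
have rs0 z : z \in rs -> 0 <= z.
  move=> zrs; apply: (@eigenvalue_gram_ge0 _ _ A).
  by rewrite eigenvalue_root_char Hrs root_prod_XsubC.
have szrs : size rs = n.
  by have := size_char_poly M; rewrite Hrs size_prod_XsubC => -[].
pose t := sort >=%R [seq Num.sqrt (complex.Re z) | z <- rs].
have szt : size t = n by rewrite size_sort size_map.
have tge : sorted >=%R t by apply: sort_sorted => x y; rewrite /= orbC le_total.
exists [ffun k : 'I_n => t`_k]; split; last split.
- move=> k; rewrite ffunE.
  have : t`_k \in t by rewrite mem_nth ?szt.
  by rewrite mem_sort => /mapP[z _ ->]; rewrite sqrtr_ge0.
- move=> k l kl; rewrite !ffunE.
  apply: (sorted_leq_nth _ _ 0 tge) => //; rewrite ?inE ?szt //.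
  by move=> y x z /= xy yz; exact: le_trans yz xy.
  by move=> x; exact: lexx.
rewrite Hrs; under [RHS]eq_bigr do rewrite ffunE.
rewrite -(big_mkord xpredT (fun k => 'X - ((t`_k ^+ 2)%:C)%C%:P)) -szt.
rewrite -(big_nth 0 xpredT (fun x => 'X - ((x ^+ 2)%:C)%C%:P)).
(* The product ignores the order of its factors, so the sorting can be undone. *)
rewrite [RHS](perm_big [seq Num.sqrt (complex.Re z) | z <- rs]) ?perm_sort //=.
rewrite big_map big_seq [RHS]big_seq; apply: eq_bigr => z /rs0.
case: z => a b; rewrite lecE /= => /andP[/eqP -> a0].
by rewrite sqr_sqrtr.
Qed.

Lemma singvalsP (R : realType) n (A : 'M[R[i]]_n) : is_singvals A (singvals A).
Proof. exact: (xgetPex [ffun => 0] (is_singvals_exists A)). Qed.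

(** Both sides are the trace of [adjmx A *m A], read off the subleading coefficient of its
    characteristic polynomial. *)
Lemma sum_singvals_sqr (R : realType) n (A : 'M[R[i]]_n) (s : {ffun 'I_n -> R}) :
  is_singvals A s -> \sum_k s k ^+ 2 = frob2 A.
Proof.
move=> [_ [_ E]].
(* In size 0 there is no subleading coefficient, and both sums are empty. *)
case: n A s E => [A s _|n A s E]; first by rewrite /frob2 !big_ord0.
have := char_poly_trace (adjmx A *m A) (ltn0Sn n).
rewrite mxtrace_mulC tr_mul_adjmx E.
pose ss := [seq ((s k ^+ 2)%:C)%C | k <- enum 'I_n.+1].
have szs : size ss = n.+1 by rewrite size_map size_enum_ord.
have -> : \prod_(k < n.+1) ('X - ((s k ^+ 2)%:C)%C%:P) = \prod_(c <- ss) ('X - c%:P).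
  by rewrite big_map big_enum.
have := @coefPn_prod_XsubC _ ss; rewrite szs => -> // /oppr_inj.
by rewrite big_map big_enum /= -rmorph_sum => -[].
Qed.

(** Both sides are the determinant of [adjmx A *m A], compared through the constant coefficient,
    where the sign [(-1)^n] cancels. *)
Lemma prod_singvals_sqr (R : realType) n (A : 'M[R[i]]_n) (s : {ffun 'I_n -> R}) :
  is_singvals A s -> \prod_k s k ^+ 2 = nm (\det A) ^+ 2.
Proof.
move=> [_ [_ E]].
have := char_poly_det (adjmx A *m A).
rewrite E -horner_coef0 horner_prod.
under eq_bigr do rewrite !hornerE -mulN1r.
rewrite big_split /= prodr_const card_ord => /(mulfI _).
rewrite signr_eq0 => /(_ isT).
rewrite det_mulmx /adjmx det_tr det_map_mx mulrC -nm_sqr -rmorph_prod => -[] //.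
Qed.

(* Each ratio [b k / a k] is at most the product of all of them, the others being
   at least 1. *)
Lemma sum_le_of_prod_le (R : realType) n (a b : 'I_n -> R) (e : R) :
  (forall k, 0 <= a k <= b k) -> 0 < \prod_k a k ->
  \prod_k b k <= (1 + e) * \prod_k a k -> \sum_k b k <= (1 + e) * \sum_k a k.
Proof.
move=> ab a0 H; rewrite mulr_sumr; apply: ler_sum => k _.
have split_k (s : 'I_n -> R) : \prod_i s i = s k * \prod_(i | i != k) s i.
  by rewrite (bigD1 k).
move: H a0; rewrite !split_k.
set P := \prod_(i | _) b i; set Q := \prod_(i | _) a i => H a0.
have Q0 : 0 <= Q by apply: prodr_ge0 => i _; have /andP[] := ab i.
have QP : Q <= P by apply: ler_prod => i _; exact: ab.
have Qp : 0 < Q.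
  by rewrite lt_neqAle Q0 andbT; apply: contraTneq a0 => <-; rewrite mulr0 ltxx.
rewrite -(ler_pM2r Qp) -(mulrA (1 + e)); apply: le_trans H.
by rewrite ler_wpM2l //; have /andP[/le_trans] := ab k; apply.
Qed.

Lemma singvals_sqr_le (R : realType) n (A : 'M[R[i]]_n) (s t : {ffun 'I_n -> R}) k :
  is_singvals A s -> s k <= t k -> 0 <= s k ^+ 2 <= t k ^+ 2.
Proof.
by move=> [/(_ k) s0 _] st; rewrite sqr_ge0 lerXn2r ?nnegrE // (le_trans s0).
Qed.

Lemma frob2_le_of_singvals_det (R : realType) n (A B : 'M[R[i]]_n)
    (s t : {ffun 'I_n -> R}) (e : R) :
  is_singvals A s -> is_singvals B t -> \det A != 0 -> (forall k, s k <= t k) ->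
  nm (\det B) ^+ 2 <= (1 + e) * nm (\det A) ^+ 2 -> frob2 B <= (1 + e) * frob2 A.
Proof.
move=> As Bt dA st.
rewrite -(prod_singvals_sqr As) -(prod_singvals_sqr Bt).
rewrite -(sum_singvals_sqr As) -(sum_singvals_sqr Bt).
apply: sum_le_of_prod_le => [k|]; first exact: singvals_sqr_le As (st k).
by rewrite (prod_singvals_sqr As) exprn_gt0 ?nm_gt0.
Qed.

Lemma nm_det_le (R : realType) n (A B : 'M[R[i]]_n) (s t : {ffun 'I_n -> R}) :
  is_singvals A s -> is_singvals B t -> (forall k, s k <= t k) ->
  nm (\det A) <= nm (\det B).
Proof.
move=> As Bt st; have : nm (\det A) ^+ 2 <= nm (\det B) ^+ 2.
  rewrite -(prod_singvals_sqr As) -(prod_singvals_sqr Bt).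
  by apply: ler_prod => k _; exact: singvals_sqr_le As (st k).
by rewrite ler_pXn2r ?nnegrE ?nm_ge0.
Qed.

(** * From flat determinant to flat matrix function *)

(** The conjugate falls on the first argument, so that [mxdot A (F h)] is a linear combination of
    the entries of [F h] and inherits their jets. *)
Definition mxdot (R : realType) m n (A B : 'M[R[i]]_(m, n)) : R[i] :=
  \sum_i \sum_j Num.conj (A i j) * B i j.

Lemma frob2_sub (R : realType) m n (A B : 'M[R[i]]_(m, n)) :
  frob2 (B - A) = frob2 B + frob2 A - 2 * complex.Re (mxdot A B).
Proof.
have Re_sum (I : Type) (r : seq I) (F : I -> R[i]) :
    complex.Re (\sum_(i <- r) F i) = \sum_(i <- r) complex.Re (F i).
  by apply: (big_morph (@complex.Re R)) => // -[a b] [c d].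
rewrite /frob2 /mxdot Re_sum mulr_sumr -big_split -sumrB /=; apply: eq_bigr => i _.
rewrite Re_sum mulr_sumr -big_split -sumrB /=; apply: eq_bigr => j _.
rewrite !mxE; case: (A i j) (B i j) => [a b] [c d].
rewrite /= !sqr_sqrtr ?addr_ge0 ?sqr_ge0 //=.
ring.
Qed.

Lemma mxdot_self (R : realType) m n (A : 'M[R[i]]_(m, n)) :
  mxdot A A = ((frob2 A)%:C)%C.
Proof.
rewrite /mxdot /frob2 rmorph_sum; apply: eq_bigr => i _.
by rewrite rmorph_sum; apply: eq_bigr => j _; rewrite mulrC -nm_sqr.
Qed.

Lemma frob2_sub_flat (R : realType) n (F : R[i] -> 'M[R[i]]_n)
    (s : R[i] -> {ffun 'I_n -> R}) N : (0 < N)%N ->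
  (forall h, is_singvals (F h) (s h)) ->
  (forall i j, jet N (fun h => F h i j)) -> \det (F 0) != 0 ->
  (\forall h \near (0 : R[i]), forall k, s 0 k <= s h k) ->
  exists C : R, \forall h \near (0 : R[i]), frob2 (F h - F 0) <= C * nm h ^+ N.
Proof.
move=> N0 Fs jF d0 H; set A := F 0 in d0 *.
have /eqO_C[C1 C10 HD] : eqO N (fun h => \det (F h)) (fun=> \det A).
  apply: jet_min_modulus => //; first exact: jet_det.
  by near=> h; apply: (nm_det_le (Fs 0) (Fs h)); near: h.
set d := nm (\det A) in HD.
have dp : 0 < d by rewrite nm_gt0.
(* Expand [(d + C1 x)^2] with [x = nm h ^+ N], use [x^2 <= x], and divide by [d^2] to get a relative
   excess. *)
pose C2 := (2 * d * C1 + C1 ^+ 2) / d ^+ 2.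
have HF : \forall h \near (0 : R[i]), frob2 (F h) <= (1 + C2 * nm h ^+ N) * frob2 A.
  near=> h; apply: (frob2_le_of_singvals_det (Fs 0) (Fs h)) => //; first by near: h.
  have x1 : nm h ^+ N <= 1.
    by rewrite exprn_ile1 ?nm_ge0 // ltW //; near: h; exact: near_nm_lt.
  have x0 : 0 <= nm h ^+ N by rewrite exprn_ge0 ?nm_ge0.
  have Dh : nm (\det (F h) - \det A) <= C1 * nm h ^+ N by near: h.
  have Dd : nm (\det (F h)) <= d + C1 * nm h ^+ N.
    rewrite -[X in nm X](subrK (\det A)) addrC; apply: le_trans (nmD _ _) _.
    by rewrite lerD2l.
  rewrite -/d; apply: (@le_trans _ _ ((d + C1 * nm h ^+ N) ^+ 2)).
    by rewrite lerXn2r ?nnegrE ?nm_ge0 // (le_trans (nm_ge0 _) Dd).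
  have -> : (1 + C2 * nm h ^+ N) * d ^+ 2
          = d ^+ 2 + (2 * d * C1 + C1 ^+ 2) * nm h ^+ N.
    by rewrite /C2; field; exact: lt0r_neq0.
  have : C1 ^+ 2 * (nm h ^+ N) ^+ 2 <= C1 ^+ 2 * nm h ^+ N.
    by rewrite ler_wpM2l ?sqr_ge0 // expr2 ler_piMr.
  by rewrite sqrrD exprMn; lra.
have /eqO_C[C3 C30 Hg] : eqO N (fun h => mxdot A (F h)) (fun=> mxdot A (F 0)).
  (* Nonnegativity of [frob2 (F h - A)] bounds twice the real part by [frob2 (F h) + frob2 A], hence
     the halved constant. *)
  apply: (@jet_max_Re _ _ _ (C2 * frob2 A / 2)) => //.
    by apply: jet_sum => i; apply: jet_sum => j; apply: jetM => //; exact: jetC.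
  near=> h.
  have Fh : frob2 (F h) <= (1 + C2 * nm h ^+ N) * frob2 A by near: h.
  have := frob2_ge0 (F h - A); rewrite frob2_sub -/A mxdot_self /=; lra.
(* The first summand is the excess of [frob2 (F h)], the second twice the deviation of the inner
   product. *)
exists (C2 * frob2 A + 2 * C3); near=> h.
have Fh : frob2 (F h) <= (1 + C2 * nm h ^+ N) * frob2 A by near: h.
have gh : nm (mxdot A (F h) - mxdot A (F 0)) <= C3 * nm h ^+ N by near: h.
have := Re_le_nm (- (mxdot A (F h) - mxdot A (F 0))); rewrite nmN.
have -> : complex.Re (- (mxdot A (F h) - mxdot A (F 0)))
        = frob2 A - complex.Re (mxdot A (F h)).
  by rewrite -/A mxdot_self; case: (mxdot _ _) => x y /=; ring.
rewrite frob2_sub; lra.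
Unshelve. all: by end_near. Qed.

(** * Local constancy and the identity theorem *)

Lemma near_mx_eq (R : realType) m n (F : R[i] -> 'M[R[i]]_(m, n))
    (A : 'M[R[i]]_(m, n)) (z : R[i]) :
  (forall i j, \forall y \near z, F y i j = A i j) -> \forall y \near z, F y = A.
Proof.
move=> H; have FF : Filter (nbhs z) := nbhs_filter z.
have H1 i := @filter_forall _ _ (fun j y => F y i j = A i j) _ FF (H i).
have := @filter_forall _ _ (fun i y => forall j, F y i j = A i j) _ FF H1.
by apply: filterS => y E; apply/matrixP.
Qed.

(** An entry with a leading term of order [m] would make [frob2 (F (z + h) - F z)] at least
    [k^2 |h|^(2m)], against flatness to order [2m + 1]. *)
Lemma analytic_locally_constant (R : realType) n (Om : set R[i])
    (F : R[i] -> 'M[R[i]]_n) (s : R[i] -> {ffun 'I_n -> R}) (z : R[i]) :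
  (forall y, is_singvals (F y) (s y)) -> mx_analytic_on Om F -> Om z -> \det (F z) != 0 ->
  (\forall h \near (0 : R[i]), forall k, s z k <= s (z + h) k) ->
  \forall h \near (0 : R[i]), F (z + h) = F z.
Proof.
move=> Fs Fan Omz dz H.
have entry i j : \forall h \near (0 : R[i]), F (z + h) i j = F z i j.
  have [_ [//|[m [a lf]]]] := analytic_local (Fan i j) Omz; exfalso.
  have [k k0 Hk] := leading_lower lf.
  have jF N i' j' : jet N (fun h => F (z + h) i' j').
    by have [+ _] := analytic_local (Fan i' j') Omz; exact.
  have [C HC] : exists C : R, \forall h \near (0 : R[i]),
      frob2 (F (z + h) - F (z + 0)) <= C * nm h ^+ (m * 2).+1.
    by apply: (@frob2_sub_flat _ _ (fun h => F (z + h)) (fun h => s (z + h))) => //; rewrite ?addr0.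
  have /near0P[r r0 Hr] : \forall h \near (0 : R[i]),
      k ^+ 2 * nm h ^+ (m * 2) <= C * nm h ^+ (m * 2).+1.
    near=> h.
    have E1 : k * nm h ^+ m <= nm (F (z + h) i j - F (z + 0) i j) by near: h.
    have E2 : frob2 (F (z + h) - F (z + 0)) <= C * nm h ^+ (m * 2).+1 by near: h.
    apply: le_trans E2; apply: le_trans (entry_le_frob2 _ i j).
    rewrite !mxE exprM -exprMn lerXn2r ?nnegrE ?nm_ge0 //.
    by rewrite mulr_ge0 ?exprn_ge0 ?nm_ge0 // ltW.
  apply: (@pow_small_absurd R (m * 2) (k ^+ 2) C r) => //; first by rewrite exprn_gt0.
  move=> t /andP[t0 tr].
  have nt : nm (t%:C)%C = t by rewrite nm_real gtr0_norm.
  by have := Hr (t%:C)%C; rewrite nt; exact.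
exact: (@near_mx_eq _ _ _ (fun h => F (z + h)) (F z) 0 entry).
Unshelve. all: by end_near. Qed.

Lemma near_shift0 (R : realType) (z : R[i]) (P : R[i] -> Prop) :
  (\forall w \near z, P w) <-> \forall h \near (0 : R[i]), P (z + h).
Proof.
split; [move/nbhs_normP => [e e0 H]|move/nbhs_normP => [e e0 H]];
  apply/nbhs_normP; exists e => // w; rewrite /ball_ /= => we.
- by apply: H; rewrite /ball_ /= opprD addrA subrr.
- have -> : w = z + (w - z) by ring.
  apply: H; rewrite /ball_ /= sub0r normrN distrC //.
Qed.

(** If [f] had a leading term at [w], then [f w = c] would make [w] an isolated solution of [f = c],
    while [f w != c] would exclude solutions near [w] by continuity. *)
Lemma analytic_const_closure (R : realType) (Om : set R[i]) (f : R[i] -> R[i])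
    (c w : R[i]) :
  analytic_on Om f -> Om w -> closure [set z | \forall y \near z, f y = c] w ->
  \forall y \near w, f y = c.
Proof.
move=> fan Omw cw.
(* Any property valid near 0 holds at some displacement [h] for which [f] equals [c] around
   [w + h]. *)
have freq (P : R[i] -> Prop) : (\forall h \near (0 : R[i]), P h) ->
    exists h, P h /\ \forall y \near w + h, f y = c.
  move=> HP; have /cw[y [fy Py]] : nbhs w [set y | P (y - w)].
    by apply/near_shift0; apply: filterS HP => h Ph /=; rewrite addrAC subrr add0r.
  have E : w + (y - w) = y by ring.
  by exists (y - w); rewrite E; split; [exact: Py | exact: fy].
have [_ [fw|[m [a lf]]]] := analytic_local fan Omw.
  have [h [fh /nbhs_singleton fc]] := freq _ fw.
  by apply/near_shift0; rewrite -fc fh.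
have [k k0 Hk] := leading_lower lf.
have [fwc|fwc] := eqVneq (f w) c.
  have [h [Hh fc]] := freq _ Hk.
  (* The closure may supply [w] itself; the conclusion is then immediate. *)
  have [h0|h0] := eqVneq h 0; first by rewrite h0 addr0 in fc.
  exfalso; move: Hh; rewrite addr0 (nbhs_singleton fc) fwc subrr nm0.
  by apply/negP; rewrite -ltNge mulr_gt0 ?exprn_gt0 ?nm_gt0.
exfalso; have [m0 a0 lO] := lf.
have [C C0 HC] : exists2 C : R, 0 <= C & \forall h \near (0 : R[i]),
    nm (f (w + h) - f w) <= C * nm h.
  have : eqO 1 (fun h => f (w + h)) (fun h => f w).
    apply: (@eqO_trans _ _ _ (fun h => f w + a * h ^+ m)).
      by rewrite -{2}[w]addr0; exact: eqO_le lO.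
    exists (nm a); near=> h; rewrite [X in nm X](_ : _ = a * h ^+ m); last by ring.
    rewrite nmM nmX ler_wpM2l ?nm_ge0 // ler_wiXn2l ?nm_ge0 //.
    by apply: ltW; near: h; exact: near_nm_lt.
  by move=> /eqO_C[C C0 HC]; exists C.
have e0 : 0 < nm (f w - c) by rewrite nm_gt0 subr_eq0.
have : \forall h \near (0 : R[i]), f (w + h) != c.
  near=> h; apply/eqP => fc.
  have E : nm (f (w + h) - f w) <= C * nm h by near: h.
  have hr : nm h < nm (f w - c) / (C + 1).
    by near: h; apply: near_nm_lt; rewrite divr_gt0 // ltr_wpDl.
  move: E; rewrite fc nm_distC; move: hr; rewrite ltr_pdivlMr ?ltr_wpDl //.
  by have := nm_ge0 h; lra.
move=> /freq[h [+ /nbhs_singleton fc]]; by rewrite fc eqxx.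
Unshelve. all: by end_near. Qed.

Lemma locally_constant_connected (R : realType) n (Om : set R[i]) (F : R[i] -> 'M[R[i]]_n) (z0 : R[i]) :
  open Om -> connected Om -> mx_analytic_on Om F -> Om z0 ->
  (\forall y \near z0, F y = F z0) -> forall z, Om z -> F z = F z0.
Proof.
move=> oOm cOm Fan Omz0 F0.
(* Asking for equality on a whole neighbourhood makes [E] open at once; that it is closed relative
   to [Om] is the identity theorem. *)
pose E : set R[i] := [set z | \forall y \near z, F y = F z0].
have oE : open E.
  rewrite openE => z /= Ez; exact: nbhs_interior.
have clE : Om `&` closure E `<=` E.
  move=> w [Omw cw].
  apply: near_mx_eq => i j; apply: (analytic_const_closure (Fan i j)) => //.
  by apply: closureS cw => z /=; apply: filterS => y ->.
have EE : Om `&` E = Om.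
  apply: cOm.
  - by exists z0.
  - by exists E.
  exists (closure E); first exact: closed_closure.
  apply/seteqP; split=> [z [Oz /subset_closure cz]|z Hz]; first by [].
  by split; [case: Hz | exact: clE].
by move=> z; rewrite -EE => -[_ /nbhs_singleton].
Qed.

Theorem theorem9 (R : realType) (n : nat) (Om : set R[i])
    (F : R[i] -> 'M[R[i]]_n) (z0 : R[i]) :
  region Om ->
  mx_analytic_on Om F ->
  (exists z w, Om z /\ Om w /\ F z <> F w) ->
  Om z0 ->
  (forall (k : 'I_n) (z : R[i]), Om z -> singvals (F z0) k <= singvals (F z) k) ->
  F z0 \notin unitmx.
Proof.
move=> [_ [oOm cOm]] Fan [z [w [Oz [Ow Fzw]]]] Oz0 smin.
apply/negP; rewrite unitmxE unitfE => d0; apply: Fzw.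
(* Openness turns the minimum over [Om] into a local minimum at [z0]. *)
have nearOm : \forall h \near (0 : R[i]), Om (z0 + h).
  by apply: (near_shift0 z0 Om).1; apply: open_nbhs_nbhs; split.
have F0 : \forall y \near z0, F y = F z0.
  apply/near_shift0; apply: (analytic_locally_constant (fun y => singvalsP (F y)) Fan Oz0 d0).
  by apply: filterS nearOm => h Oh k; exact: smin.
by rewrite !(locally_constant_connected oOm cOm Fan Oz0 F0).
Qed.
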